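(* Let $\Bbbk$ be a field of characteristic zero, $t\in\Bbbk$, $n\in\mathbb N\cup\{\infty\}$, $\beta,\delta\in\Lambda(n)_t$, and $q=(q_{i,j})\in\mathcal{M}at_n(\delta,\beta)_t$. Then the morphism $\xi_q:\mathcal X^\beta\to\mathcal X^\delta$ of $\operatorname{Perm}(\mathfrak S_\infty;\mu_t)$ is negligible if and only if $t\in\mathbb Z_{\ge0}$ and $q_{1,1}<0$.
   Context: Combinatorics. $\mathbb N=\{1,2,\dots\}$ and $[1,n]=\{1,\dots,n\}$ ($[1,\infty]=\mathbb N$). $\Lambda(n)_t$ is the set of sequences $\beta=(\beta_i)_{i\in[1,n]}$ with $\beta_1\in t-\mathbb Z$, $\beta_i\in\mathbb Z_{\ge 0}$ for $i\ge 2$ (all but finitely many equal to $0$), and $\sum_i\beta_i=t$. For $\beta,\delta\in\Lambda(n)_t$, $\mathcal{M}at_n(\delta,\beta)_t$ is the set of matrices $q=(q_{i,j})_{i,j\in[1,n]}$ with $q_{1,1}\in t-\mathbb Z$, all other $q_{i,j}\in\mathbb Z_{\ge0}$, $\sum_{i,j}q_{i,j}=t$, column sums $\sum_i q_{i,j}=\beta_j$ and row sums $\sum_j q_{i,j}=\delta_i$. The category. $\mathfrak S_\infty$ is the group of all bijections of $\Omega=\mathbb N$, with the topology in which the pointwise stabilizers of finite subsets of $\Omega$ form a base of open neighborhoods of the identity. An action of an open subgroup $U$ on a set is smooth if all point stabilizers are open. A finitary $\widehat{\mathfrak S}_\infty$-set is a set with a smooth action of some open subgroup $U\subseteq\mathfrak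 S_\infty$ having finitely many orbits (one may shrink $U$); a finitary $\mathfrak S_\infty$-set is a smooth $\mathfrak S_\infty$-set with finitely many orbits. Let $\mathfrak S(p)$ be the pointwise stabilizer of $\{1,\dots,p\}$. For a finitary $\widehat{\mathfrak S}_\infty$-set $X$ there is a unique polynomial $p_X\in\mathbb Q[T]$ with $p_X(p)=|X^{\mathfrak S(p)}|$ for all sufficiently large integers $p$; set $\mu_t(X)=p_X(t)$. If $f:X\to\Bbbk$ is constant on the orbits of such an open subgroup, put $\int_X f(x)\,dx=\sum_c c\,\mu_t(f^{-1}(c))$, the sum being over the finitely many values $c$ of $f$. The category $\operatorname{Perm}(\mathfrak S_\infty;\mu_t)$ has as objects the finitary $\mathfrak S_\infty$-sets; $\operatorname{Hom}(X,Y)$ is the space of functions $Y\times X\to\Bbbk$ constant on the diagonal $\mathfrak S_\infty$-orbits; composition is $(g\circ f)(z,x)=\int_Y g(z,y)f(y,x)\,dy$. The trace of $f\in\operatorname{End}(X)$ is $\operatorname{tr}(f)=\int_X f(x,x)\,dx$. A morphism $f:X\to Y$ is negligible if $\operatorname{tr}(f\circ g)=\operatorname{tr}(g\circ f)=0$ for all morphisms $g:Y\to X$. The morphisms $\xi_q$. For $\beta\in\Lambda(n)_t$ and $k\ge2$ let $\{\beta\}_k=[1+\sum_{i=2}^{k-1}\beta_i,\ \sum_{i=2}^{k}\beta_i]\subset\Omega$ and $\{\beta\}_1=\Omega\setminus\bigcup_{k\ge2}\{\beta\}_k$. $\mathfrak S_\beta\le\mathfrak S_\infty$ is the subgroup preserving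 each $\{\beta\}_k$, and $\mathcal X^\beta=\mathfrak S_\infty/\mathfrak S_\beta$. For $q\in\mathcal{M}at_n(\delta,\beta)_t$, $\xi_q\in\operatorname{Hom}(\mathcal X^\beta,\mathcal X^\delta)$ is the indicator function of the $\mathfrak S_\infty$-orbit of $(\mathfrak S_\delta,\sigma\mathfrak S_\beta)$ in $\mathcal X^\delta\times\mathcal X^\beta$, where $\sigma\in\mathfrak S_\infty$ is any element with $|\{\delta\}_i\cap\sigma(\{\beta\}_j)|=q_{i,j}$ for all $(i,j)\ne(1,1)$. *)

(* Defs.v *)
From HB Require Import structures.
From mathcomp Require Import all_boot all_order all_algebra.
From mathcomp Require Import all_classical.

Set Implicit Arguments.
Unset Strict Implicit.
Unset Printing Implicit Defensive.

Local Open Scope classical_set_scope.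
Local Open Scope card_scope.
Local Open Scope ring_scope.

Definition Omega := {i : nat | (0 < i)%N}.

(* All bijections of [Omega = {1, 2, ...}]; the inverse is determined by the map. *)
Record Sinf := MkSinf {
  sinf_fun :> Omega -> Omega;
  sinf_inv : Omega -> Omega;
  sinf_funK : cancel sinf_fun sinf_inv;
  sinf_invK : cancel sinf_inv sinf_fun }.

Lemma sinfP (s u : Sinf) : s =1 u -> s = u.
Proof.
case: s u => [f f' fK f'K] [g g' gK g'K] /= /funext e.
rewrite -{}e in gK g'K *.
have e' : f' = g' by apply/funext => x; rewrite -{1}[x]g'K fK.
by rewrite -{}e' in gK g'K *; congr MkSinf; exact: Prop_irrelevance.
Qed.

Definition sinf_id : Sinf :=
  @MkSinf id id (fun=> erefl) (fun=> erefl).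
Definition sinf_comp (s u : Sinf) : Sinf :=
  MkSinf (can_comp (sinf_funK s) (sinf_funK u))
         (can_comp (sinf_invK u) (sinf_invK s)).
Definition sinf_opp (s : Sinf) : Sinf :=
  MkSinf (sinf_invK s) (sinf_funK s).

Fact sinf_compA : associative sinf_comp.
Proof. by move=> s u v; exact: sinfP. Qed.
Fact sinf_comp1s : left_id sinf_id sinf_comp.
Proof. by move=> s; exact: sinfP. Qed.
Fact sinf_comps1 : right_id sinf_id sinf_comp.
Proof. by move=> s; exact: sinfP. Qed.
Fact sinf_compVs : left_inverse sinf_id sinf_opp sinf_comp.
Proof. by move=> s; apply: sinfP => x /=; exact: sinf_funK. Qed.
Fact sinf_compsV : right_inverse sinf_id sinf_opp sinf_comp.
Proof. by move=> s; apply: sinfP => x /=; exact: sinf_invK. Qed.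

HB.instance Definition _ := gen_eqMixin Sinf.
HB.instance Definition _ := gen_choiceMixin Sinf.
HB.instance Definition _ := isGroup.Build Sinf
  sinf_compA sinf_comp1s sinf_comps1 sinf_compVs sinf_compsV.

Definition ptstab (F : set Omega) : set Sinf :=
  [set s | forall x, F x -> s x = x].

Definition Sp (p : nat) : set Sinf := ptstab [set x | (val x <= p)%N].

Definition lcos (s : Sinf) (A : set Sinf) : set Sinf :=
  [set (s * a)%g | a in A].

(* The group topology whose neighborhoods of 1 are generated by the [ptstab F],
   [F] finite. *)
Definition sinf_open (O : set Sinf) : Prop :=
  forall s, O s -> exists2 F, finite_set F & lcos s (ptstab F) `<=` O.

Record open_subgroup := OpenSubgroup {
  osg_set :> set Sinf;
  osg1 : osg_set 1%g;
  osgM : forall s u, osg_set s -> osg_set u -> osg_set (s * u)%g;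
  osgV : forall s, osg_set s -> osg_set (s^-1)%g;
  osg_open : sinf_open osg_set }.

Record finitary_set := FinitarySet {
  carrier :> Type;
  act : Sinf -> carrier -> carrier;
  act1 : forall x, act 1%g x = x;
  actM : forall s u x, act (s * u)%g x = act s (act u x);
  act_smooth : forall x, sinf_open [set s | act s x = x];
  act_orbits : finite_set (range (fun x => range (act^~ x))) }.

Section CosetSpace.
Variable U : open_subgroup.

Definition coset_space := {A : set Sinf | exists s, A = lcos s U}.

Definition coset_of (s : Sinf) : coset_space :=
  exist _ (lcos s U) (ex_intro _ s erefl).

Lemma lcosM s u (A : set Sinf) : lcos (s * u)%g A = lcos s (lcos u A).
Proof.
rewrite predeqE => x; split.
  move=> [a Aa <-]; exists (u * a)%g; first by exists a.
  by rewrite mulgA.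
by move=> [_ [a Aa <-] <-]; exists a; rewrite // mulgA.
Qed.

Fact coset_act_subproof (s : Sinf) (x : coset_space) :
  exists u, lcos s (sval x) = lcos u U.
Proof. by have [u ->] := svalP x; exists (s * u)%g; rewrite lcosM. Qed.

Definition coset_act (s : Sinf) (x : coset_space) : coset_space :=
  exist _ (lcos s (sval x)) (coset_act_subproof s x).

Lemma coset_space_inj (x y : coset_space) : sval x = sval y -> x = y.
Proof. by case: x y => [A a] [B b] /= AB; exact: eq_exist. Qed.

Lemma coset_actE s u : coset_act s (coset_of u) = coset_of (s * u)%g.
Proof. by apply: coset_space_inj; rewrite /= lcosM. Qed.

Lemma coset_ofP (x : coset_space) : exists s, x = coset_of s.
Proof. by case: x => A [s As]; exists s; exact: coset_space_inj. Qed.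

Fact coset_act1 x : coset_act 1%g x = x.
Proof. by have [s ->] := coset_ofP x; rewrite coset_actE mul1g. Qed.

Fact coset_actM s u x : coset_act (s * u)%g x = coset_act s (coset_act u x).
Proof. by have [v ->] := coset_ofP x; rewrite !coset_actE mulgA. Qed.

Lemma coset_of_mulr s u : osg_set U u -> coset_of (s * u)%g = coset_of s.
Proof.
move=> Uu; apply: coset_space_inj; rewrite /= predeqE => x; split.
  by move=> [a Ua <-]; exists (u * a)%g; [exact: osgM | rewrite mulgA].
move=> [a Ua <-]; exists (u^-1 * a)%g; first by apply: osgM => //; exact: osgV.
by rewrite -mulgA mulVKg.
Qed.

Fact coset_act_smooth x : sinf_open [set s | coset_act s x = x].
Proof.
have [v ->] := coset_ofP x => s /= sv.
have [F Ffin FU] := osg_open (osg1 U).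
exists (v @` F); first exact: finite_image.
move=> _ [a aF <-] /=; rewrite coset_actM -[RHS]sv; congr coset_act.
have -> : (coset_act a (coset_of v) = coset_of (v * (v^-1 * (a * v))))%g.
  by rewrite coset_actE mulVKg.
apply: coset_of_mulr; apply: FU; exists (v^-1 * (a * v))%g; last by rewrite mul1g.
move=> y Fy; rewrite -[RHS](sinf_funK v).
by congr (sinf_inv v); apply: aF; exists y.
Qed.

Fact coset_act_orbits :
  finite_set (range (fun x : coset_space => range (coset_act^~ x))).
Proof.
apply: (@sub_finite_set _ _ [set setT]); last exact: finite_set1.
move=> _ [x _ <-] /=; rewrite predeqE => y; split => // _.
have [s ->] := coset_ofP x; have [u ->] := coset_ofP y.
by exists (u * s^-1)%g; rewrite // coset_actE mulgVK.
Qed.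

Definition coset_set : finitary_set :=
  FinitarySet coset_act1 coset_actM coset_act_smooth coset_act_orbits.

End CosetSpace.

Section Perm.
Variables (k : fieldType) (t : k).

Section Measure.
Variable X : finitary_set.

Definition fixed_pts (A : set X) (p : nat) : set X :=
  [set x | A x /\ forall s, Sp p s -> act s x = x].

Definition counts (A : set X) (P : {poly rat}) : Prop :=
  exists p0 : nat, forall p : nat, (p0 <= p)%N ->
    exists2 m : nat, fixed_pts A p #= `I_m & P.[p%:R] = m%:R.

(* [A] stands for a finitary set of its own: it is meant to be stable under some
   open subgroup of [Sinf], which acts on it by restriction. The polynomial is
   then unique, so that the choice made by [xget] is irrelevant. *)
Definition mu (A : set X) : k := (map_poly ratr (xget 0 (counts A))).[t].

(* The sum ranges over the nonzero [c * mu _] and is meant for [f] with finitely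
   many values. *)
Definition integral (f : X -> k) : k :=
  \sum_(c \in range f) c * mu (f @^-1` [set c]).

End Measure.

(* A morphism [X -> Y], as a function on [Y * X] (in curried form). *)
Record hom (X Y : finitary_set) := Hom {
  hom_fun :> Y -> X -> k;
  hom_inv : forall s y x, hom_fun (act s y) (act s x) = hom_fun y x }.

(* Composition and trace are given on the underlying functions, so that no
   proof of invariance of the composite is required to take its trace. *)
Definition comp (X Y Z : finitary_set) (g : Z -> Y -> k) (f : Y -> X -> k) :
  Z -> X -> k := fun z x => integral (fun y => g z y * f y x).

Definition tr (X : finitary_set) (f : X -> X -> k) : k :=
  integral (fun x => f x x).

Definition negligible (X Y : finitary_set) (f : hom X Y) : Prop :=
  forall g : hom Y X, tr (comp f g) = 0 /\ tr (comp g f) = 0.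

(* [Some m] stands for [m >= 1] and [None] for infinity; [idx n] is [1, n]. *)
Definition idx (n : option Omega) :=
  {i : nat | (0 < i)%N && (if n is Some m then (i <= val m)%N else true)}.

Fact idx1_subproof n :
  (0 < 1)%N && (if n is Some m then (1 <= val (m : Omega))%N else true).
Proof. by case: n => //= m; exact: (valP m). Qed.

Definition idx1 n : idx n := exist _ 1%N (idx1_subproof n).

Record Lambda (n : option Omega) := MkLambda {
  lam :> idx n -> k;
  lam_head : exists z : int, lam (idx1 n) = t - z%:~R;
  lam_tail : forall i, i != idx1 n -> exists m : nat, lam i = m%:R;
  lam_finite : finite_set [set i | lam i != 0];
  lam_sum : \sum_(i \in [set: idx n]) lam i = t }.

(* Finiteness of the support gives a meaning to the sums; [\sum_(_ \in _)] is 0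
   by convention over an infinite support. *)
Record Mat (n : option Omega) (delta beta : Lambda n) := MkMat {
  mat :> idx n -> idx n -> k;
  mat_head : exists z : int, mat (idx1 n) (idx1 n) = t - z%:~R;
  mat_tail : forall i j, (i, j) != (idx1 n, idx1 n) ->
    exists m : nat, mat i j = m%:R;
  mat_finite : finite_set [set ij : idx n * idx n | mat ij.1 ij.2 != 0];
  mat_sum : \sum_(ij \in [set: idx n * idx n]) mat ij.1 ij.2 = t;
  mat_col : forall j, \sum_(i \in [set: idx n]) mat i j = beta j;
  mat_row : forall i, \sum_(j \in [set: idx n]) mat i j = delta i }.

(* The natural number [m] with [x = m%:R] (unique in characteristic zero), and 0
   if there is none. *)
Definition nat_part (x : k) : nat :=
  if pselect (exists m : nat, x == m%:R) is left xm then ex_minn xm else 0%N.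

Lemma nat_part0 : nat_part 0 = 0%N.
Proof.
rewrite /nat_part; case: pselect => // x0; case: ex_minnP => m _ /(_ 0%N).
by rewrite eqxx leqn0 => /(_ isT)/eqP.
Qed.

Section Blocks.
Variables (n : option Omega) (beta : Lambda n).

Definition entry (i : nat) : nat :=
  if insub i is Some j then nat_part (beta (j : idx n)) else 0%N.

Definition block_tail (i : idx n) : set Omega :=
  [set x | (1 + \sum_(2 <= l < val i) entry l <= val x
            <= \sum_(2 <= l < (val i).+1) entry l)%N].

Definition block (i : idx n) : set Omega :=
  if i == idx1 n then ~` \bigcup_(j in [set j | j != idx1 n]) block_tail j
  else block_tail i.

Definition young : set Sinf := [set s | forall i, s @` block i = block i].

Fact young1 : young 1%g.
Proof. by move=> i; exact: image_id. Qed.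

Fact youngM s u : young s -> young u -> young (s * u)%g.
Proof. by move=> sy uy i; rewrite -[RHS]sy -[in RHS]uy -image_comp. Qed.

Fact youngV s : young s -> young (s^-1)%g.
Proof.
move=> sy i; rewrite -[in LHS]sy image_comp -[RHS]image_id.
by apply: eq_imagel => x _ /=; exact: sinf_funK.
Qed.

Lemma block_tails_finite :
  finite_set (\bigcup_(j in [set j | j != idx1 n]) block_tail j).
Proof.
apply: (@sub_finite_set _ _
    (\bigcup_(j in [set j | beta j != 0]) block_tail j)).
  move=> x [j /= j1 jx]; exists j => //=.
  apply: contraTneq (jx) => bj0; rewrite /block_tail /=.
  have j2 : (2 <= val j)%N.
    rewrite ltn_neqAle andbC; move: (valP j) => /andP[-> _] /=.
    by apply: contra j1 => /eqP j1; apply/eqP/val_inj.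
  rewrite big_nat_recr //= /entry valK bj0 nat_part0 addn0.
  by apply/negP => /andP[] /leq_trans H /H; rewrite add1n ltnn.
apply: bigcup_finite; first exact: (lam_finite beta).
move=> j _; set M := (\sum_(2 <= l < (val j).+1) entry l)%N.
apply: (@sub_finite_set _ _ (val @^-1` `I_M.+1)).
  by move=> x /andP[_] /=.
by apply: finite_preimage; [move=> x y _ _; exact: val_inj | exact: finite_II].
Qed.

Fact young_open : sinf_open young.
Proof.
move=> s sy; exists (\bigcup_(j in [set j | j != idx1 n]) block_tail j).
  exact: block_tails_finite.
move=> _ [a ay <-]; apply: youngM => // i.
have aT j : j != idx1 n -> a @` block_tail j = block_tail j.
  move=> j1; rewrite -[RHS]image_id; apply: eq_imagel => x jx.
  by apply: ay; exists j.
rewrite /block; case: ifPn => [_|/aT//].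
rewrite predeqE => x; split.
  move=> [y + <-]; apply: contra_not => ay'.
  by rewrite -[y](sinf_funK a) -{1}(ay _ ay') sinf_funK.
move=> nx; exists (sinf_inv a x); last exact: sinf_invK.
by apply: contra_not nx => ax; rewrite -[x](sinf_invK a) (ay _ ax).
Qed.

Definition Young : open_subgroup := OpenSubgroup young1 youngM youngV young_open.

Definition Xset : finitary_set := coset_set Young.

End Blocks.

Section Xi.
Variables (n : option Omega) (beta delta : Lambda n) (q : Mat delta beta).

Definition matches (s : Sinf) : Prop :=
  forall i j, (i, j) != (idx1 n, idx1 n) ->
    block delta i `&` (s @` block beta j) #= `I_(nat_part (q i j)).

(* In characteristic zero, some [s] with [matches s] always exists, and the orbit
   below does not depend on which one is taken. *)
Definition xi_rep : Sinf := xget 1%g matches.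

Definition xi_orbit : set (Xset delta * Xset beta) :=
  [set yx | exists s : Sinf,
     yx = (act s (coset_of (Young delta) 1%g : Xset delta),
           act s (coset_of (Young beta) xi_rep : Xset beta))].

Definition xi_fun (y : Xset delta) (x : Xset beta) : k :=
  (`[< xi_orbit (y, x) >])%:R.

Fact xi_inv s y x : xi_fun (act s y) (act s x) = xi_fun y x.
Proof.
congr (_%:R); congr nat_of_bool; apply: asbool_equiv_eq; split.
  move=> [u /pair_equal_spec [ey ex]]; exists (s^-1 * u)%g.
  by rewrite !actM -ey -ex -!actM mulVg !act1.
by move=> [u /pair_equal_spec [-> ->]]; exists (s * u)%g; rewrite !actM.
Qed.

Definition xi : hom (Xset beta) (Xset delta) := Hom xi_inv.

End Xi.

End Perm.

(* Main.v *)
(* Let [y0], [x0] be base points of [X^delta], [X^beta] whose orbit defines [xi q].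
   A morphism [g] is constant, say equal to [c], on that orbit, so the trace of
   [xi q] composed with [g], on either side, is [c] times an iterated integral: the
   measure of the slice [{x | (y0, x) in the orbit}] times that of [X^delta] (or
   the same with [X^beta]). If [D] and [E] are the supports (points of colour
   [<> 1]) of [y0] and [x0], with [#|D| = d] and [#|D u E| = s], counting
   injections modulo a finite group shows that these measures are nonzero rational
   multiples of [(t - d) ... (t - s + 1)] and [t (t - 1) ... (t - d + 1)]. Hence
   [xi q] is negligible iff [t (t - 1) ... (t - s + 1) = 0], and [s = t - q 1 1]. *)
Require Import Defs.
From HB Require Import structures.
From mathcomp Require Import all_boot all_order all_algebra.
From mathcomp Require Import finmap ring.
From mathcomp Require Import all_classical.

Set Implicit Arguments.
Unset Strict Implicit.
Unset Printing Implicit Defensive.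

Import GRing.Theory.
Local Open Scope classical_set_scope.
Local Open Scope card_scope.
Local Open Scope ring_scope.

(** * Fields of characteristic zero and the embedding of the rationals *)

Section CharZero.
Variables (k : fieldType) (k_char0 : [pchar k] =i pred0).

Lemma natr_eq0_char0 (m : nat) : (m%:R == 0 :> k) = (m == 0)%N.
Proof. exact: (pcharf0P k).1. Qed.

Lemma natr_inj_char0 : injective (fun m : nat => m%:R : k).
Proof.
suff le_inj (m p : nat) : (m <= p)%N -> m%:R = p%:R :> k -> m = p.
  move=> m p mp; have [h|h] := orP (leq_total m p); first exact: le_inj h mp.
  by rewrite (le_inj _ _ h (esym mp)).
move=> mp e; apply/eqP; rewrite eqn_leq mp /= -subn_eq0 -natr_eq0_char0.
by rewrite natrB // e subrr.
Qed.

Lemma intr_eq0_char0 (z : int) : (z%:~R == 0 :> k) = (z == 0).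
Proof. by case: z => m; rewrite ?NegzE ?mulrNz ?oppr_eq0 natr_eq0_char0. Qed.

(** [ratr] reads the reduced numerator and denominator. Denominators stay nonzero in characteristic
    zero, so cross multiplication leaves an identity between integers, which is checked in [rat]. *)
Lemma ratr_divE (a b : int) : b != 0 -> ratr (a%:Q / b%:Q) = a%:~R / b%:~R :> k.
Proof.
move=> b0; rewrite /ratr; set x : rat := _ / _.
have d0 : (denq x)%:~R != 0 :> k by rewrite intr_eq0_char0 denq_neq0.
have bk0 : b%:~R != 0 :> k by rewrite intr_eq0_char0.
have bq0 : b%:Q != 0 by rewrite intr_eq0.
apply/eqP; rewrite eqr_div // -!intrM; apply/eqP; congr (_%:~R).
apply: (@intr_inj rat); rewrite !intrM [in RHS]mulrC.
have -> : (numq x)%:~R = x * (denq x)%:Q by rewrite numqE.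
by rewrite mulrAC /x divfK // mulrC.
Qed.

Lemma ratr_zmod_morphism_char0 : zmod_morphism (@ratr k).
Proof.
move=> x y.
have dx0 := denq_neq0 x; have dy0 := denq_neq0 y.
have -> : x - y = (numq x * denq y - numq y * denq x)%:Q / (denq x * denq y)%:Q.
  rewrite -[in LHS](divq_num_den x) -[in LHS](divq_num_den y) -mulNr.
  by rewrite addf_div ?intr_eq0 // rmorphB !rmorphM /= mulNr.
rewrite ratr_divE ?mulf_neq0 // /ratr -[X in _ = _ + X]mulNr addf_div
  ?intr_eq0_char0 //.
by rewrite rmorphB !rmorphM /= mulNr.
Qed.

Lemma ratr_monoid_morphism_char0 : monoid_morphism (@ratr k).
Proof.
split=> [|x y]; first by rewrite /ratr divr1.
have dx0 := denq_neq0 x; have dy0 := denq_neq0 y.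
have -> : x * y = (numq x * numq y)%:Q / (denq x * denq y)%:Q.
  by rewrite -[in LHS](divq_num_den x) -[in LHS](divq_num_den y) mulf_div
    !rmorphM.
by rewrite ratr_divE ?mulf_neq0 // /ratr mulf_div !rmorphM.
Qed.

(** [ratr] bundled as a ring morphism, so that it commutes with evaluation of polynomials and is
    injective. *)
Definition ratr_char0 : {rmorphism rat -> k} :=
  HB.pack (@ratr k)
    (GRing.isZmodMorphism.Build _ _ (@ratr k) ratr_zmod_morphism_char0)
    (GRing.isMonoidMorphism.Build _ _ (@ratr k) ratr_monoid_morphism_char0).

End CharZero.

(** * Shifted falling factorials as counting polynomials *)

Definition ffact_poly (R : nzRingType) (d n : nat) : {poly R} :=
  \prod_(i < n) ('X - ((d + i)%:R)%:P).

Lemma ffact_polyE (d n p : nat) : (d <= p)%N ->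
  (ffact_poly rat d n).[p%:R] = ((p - d) ^_ n)%:R.
Proof.
move=> dp; rewrite horner_prod.
elim: n => [|n IHn]; first by rewrite big_ord0.
rewrite big_ord_recr /= IHn ffactnSr natrM hornerXsubC.
have [lt_n|ge_n] := ltnP n (p - d).
  by rewrite -natrB ?subnDA // -leq_subRL // ltnW.
(* Here [n >= p - d]: either the new factor vanishes, or the falling factorial is already zero. *)
suff [->|e] : (p - d) ^_ n = 0%N \/ (p - d)%N = n; first by rewrite !mul0r.
  by rewrite -e subnKC // subrr subnn.
move: ge_n; rewrite leq_eqVlt => /predU1P[|/ffact_small]; tauto.
Qed.

(** A nonzero difference would have as many distinct roots as its size, one more than its degree. *)
Lemma poly_eq_on_nat (P Q : {poly rat}) (p0 : nat) :
  (forall p, (p0 <= p)%N -> P.[p%:R] = Q.[p%:R]) -> P = Q.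
Proof.
move=> PQ; apply/eqP; rewrite -subr_eq0; apply/negP => /negP nz.
pose rs : seq rat := [seq p%:R | p <- iota p0 (size (P - Q))].
have rts : all (root (P - Q)) rs.
  apply/allP => _ /mapP[p + ->]; rewrite mem_iota => /andP[p0p _].
  by rewrite rootE !hornerE PQ // subrr.
have urs : uniq rs.
  rewrite map_inj_uniq ?iota_uniq // => a b /eqP.
  by rewrite Num.Theory.eqr_nat => /eqP.
by have := max_poly_roots nz rts urs; rewrite size_map size_iota ltnn.
Qed.

(** * The measure read off from a counting polynomial *)

Section Mu.
Variables (k : fieldType) (t : k).
Hypothesis k_char0 : [pchar k] =i pred0.

Lemma counts_uniq (X : finitary_set) (A : set X) (P Q : {poly rat}) :
  counts A P -> counts A Q -> P = Q.
Proof.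
move=> [p0 cP] [p1 cQ]; apply: (@poly_eq_on_nat _ _ (maxn p0 p1)) => p.
rewrite geq_max => /andP[/cP[m Am ->] /cQ[m' Am' ->]]; congr (_%:R).
by apply/card_eq_II; apply: card_eq_trans Am'; rewrite card_eq_sym.
Qed.

Lemma mu_ffact (X : finitary_set) (A : set X) (r : rat) (d n : nat) :
  counts A (r *: ffact_poly rat d n) ->
  mu t A = ratr r * \prod_(i < n) (t - (d + i)%:R).
Proof.
move=> cA; rewrite /mu.
(* By uniqueness, the polynomial chosen by [xget] is the given one. *)
have -> : xget 0 (counts A) = r *: ffact_poly rat d n.
  by apply: (counts_uniq _ cA); apply: xgetPex; exists (r *: ffact_poly rat d n).
set f := ratr_char0 k_char0.
transitivity (map_poly f (r *: ffact_poly rat d n)).[t]; first by [].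
rewrite map_polyZ hornerZ; congr (_ * _).
rewrite /ffact_poly map_prod_XsubC horner_prod; apply: eq_bigr => i _.
by rewrite hornerXsubC rmorph_nat.
Qed.

End Mu.

(** * Building permutations of [Omega] from colourings *)

HB.instance Definition _ := Countable.on Omega.
HB.instance Definition _ := isPointed.Build Omega (exist _ 1%N isT).

Lemma sinf_of_bij (h : Omega -> Omega) :
  injective h -> (forall y, exists x, h x = y) -> exists s : Sinf, s =1 h.
Proof.
move=> h_inj h_surj; pose g y := sval (cid (h_surj y)).
have gK : cancel g h by move=> y; exact: svalP (cid (h_surj y)).
have hK : cancel h g by move=> x; apply: h_inj; rewrite gK.
by exists (MkSinf hK gK).
Qed.

Lemma sinf_inj (s : Sinf) : injective s.
Proof. exact: can_inj (sinf_funK s). Qed.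

Lemma sinf_mulE (s u : Sinf) x : (s * u)%g x = s (u x). Proof. by []. Qed.

Lemma sinf_mulVE (s : Sinf) x : (s^-1)%g (s x) = x.
Proof. exact: sinf_funK. Qed.

Lemma sinf_mulEV (s : Sinf) x : s ((s^-1)%g x) = x.
Proof. exact: sinf_invK. Qed.

(** Bijections between fibers of the same colour glue to a permutation. *)
Lemma recolor (C : Type) (c c' : Omega -> C) :
  (forall i, c @^-1` [set i] #= c' @^-1` [set i]) ->
  exists h : Sinf, forall z, c' (h z) = c z.
Proof.
move=> cc'.
have /choice[F Fbij] i :
    exists f, set_bij (c @^-1` [set i]) (c' @^-1` [set i]) f.
  exact/card_set_bijP.
pose h z := F (c z) z.
have c'h z : c' (h z) = c z by have [+ _ _] := Fbij (c z); apply.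
have h_inj : injective h.
  move=> x y hxy; have cxy : c x = c y by rewrite -!c'h hxy.
  have [_ + _] := Fbij (c x); apply; rewrite ?inE //=.
  by rewrite [in RHS]cxy.
have h_surj y : exists x, h x = y.
  have [_ _ +] := Fbij (c' y) => /(_ y erefl)[x /= cx <-].
  by exists x; rewrite /h cx.
by have [s sh] := sinf_of_bij h_inj h_surj; exists s => z; rewrite sh.
Qed.

Lemma Omega_infinite : infinite_set [set: Omega].
Proof.
apply/infiniteP/pcard_injP.
by exists (fun i => exist _ i.+1 isT) => i j _ _ [].
Qed.

Lemma cofinite_Omega (A : set Omega) : finite_set (~` A) -> A #= [set: nat].
Proof.
move=> Afin; apply: eq_card_nat; first exact: countableP.
exact: cofinite_set_infinite Omega_infinite Afin.
Qed.

(** Both fibers over [i0] have finite complement, hence are countably infinite; only the other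
    fibers need comparing. *)
Lemma recolor_cofinite (C : Type) (c c' : Omega -> C) (i0 : C) :
  finite_set [set z | c z <> i0] -> finite_set [set z | c' z <> i0] ->
  (forall i, i <> i0 -> c @^-1` [set i] #= c' @^-1` [set i]) ->
  exists h : Sinf, forall z, c' (h z) = c z.
Proof.
move=> cfin c'fin cc'; apply: recolor => i.
have [->|/cc'//] := pselect (i = i0).
apply: (@card_eq_trans _ _ _ _ [set: nat]); first exact: cofinite_Omega.
by rewrite card_eq_sym; exact: cofinite_Omega.
Qed.

(** Colour [e s] (respectively [f s]) by [Some s] and all other points by [None]: a permutation
    matching these colourings extends the partial map. *)
Lemma sinf_extend (S : finType) (e f : S -> Omega) :
  injective e -> injective f -> exists h : Sinf, forall s, h (e s) = f s.
Proof.
move=> e_inj f_inj; pose col (e : S -> Omega) z := [pick s | e s == z].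
have colE (g : S -> Omega) s : injective g -> col g (g s) = Some s.
  move=> g_inj; rewrite /col; case: pickP => [u /eqP/g_inj->//|/(_ s)].
  by rewrite eqxx.
have colP (g : S -> Omega) z s : col g z = Some s -> g s = z.
  by rewrite /col; case: pickP => // u /eqP + [<-].
have fin (g : S -> Omega) : finite_set [set z | col g z <> None].
  apply: (@sub_finite_set _ _ (g @` [set: S])).
    by move=> z /=; case gz: (col g z) => [s|] // _; exists s => //; exact: colP.
  exact/finite_image/finite_finset.
have fib (g : S -> Omega) s : injective g -> col g @^-1` [set Some s] = [set g s].
  move=> g_inj; rewrite predeqE => z; split=> [/colP->//|->].
  exact: colE.
have [||s|h hE] := @recolor_cofinite _ (col e) (col f) None; do ?exact: fin.
  case: s => // s _; rewrite !fib //.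
  exact: card_eq_trans card_set1 (card_esym card_set1).
by exists h => s; apply/esym/colP; rewrite hE colE.
Qed.

(** * Counting by fibers, and the fixed points in a slice *)

Lemma card_seq (T : choiceType) (r : seq T) : uniq r -> [set` r] #= `I_(size r).
Proof.
move=> r_uniq; rewrite (_ : [set` r] = [set` [fset x in r]%fset]).
  by apply/card_eq_fsetP; rewrite card_fseq undup_id.
by apply/seteqP; split=> x /=; rewrite !inE.
Qed.

(** The fibers of [psi] partition [Phi] into classes of size [K], and the classes correspond to the
    values of [psi] on [Phi]. *)
Lemma fiber_count (F : finType) (X : Type) (Phi : {set F}) (psi : F -> X)
    (K : nat) :
  (forall f, f \in Phi -> #|[set u in Phi | `[< psi u = psi f >]]| = K) ->
  exists2 m, psi @` [set` Phi] #= `I_m & (m * K = #|Phi|)%N.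
Proof.
move=> fibK; pose R u v := `[< psi u = psi v >].
have Req : {in Phi & &, equivalence_rel R}.
  move=> u v w _ _ _; split; first exact/asboolP.
  by move=> /asboolP uv; rewrite /R uv.
have Ppart := equivalence_partitionP Req.
have unif : {in equivalence_partition R Phi, forall A : {set F}, #|A| = K}.
  move=> _ /imsetP[f fPhi ->]; rewrite -(fibK f fPhi); apply: eq_card => u.
  by rewrite !inE /R; congr andb; apply: asbool_equiv_eq; split.
exists #|equivalence_partition R Phi|; last first.
  by rewrite (card_uniform_partition unif Ppart).
set P := equivalence_partition R Phi.
pose cl (x : X) : {set F} := [set u in Phi | `[< x = psi u >]].
have clinj : {in psi @` [set` Phi] &, injective cl}.
  move=> _ y /set_mem[/= u uPhi <-] _ e.
  have : u \in cl (psi u) by rewrite inE uPhi; exact/asboolP.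
  by rewrite e inE => /andP[_ /asboolP].
apply: card_eq_trans (card_esym (inj_card_eq clinj)) _.
have -> : cl @` (psi @` [set` Phi]) = [set` P].
  rewrite predeqE => A; split=> [[_ [u /= uPhi <-] <-]|/= /imsetP[u uPhi ->]].
    by apply/imsetP; exists u.
  by exists (psi u) => //; exists u.
rewrite (_ : [set` P] = [set` enum P]); last first.
  by apply/seteqP; split=> A /=; rewrite mem_enum.
by rewrite cardE; exact: card_seq (enum_uniq _).
Qed.

(* Injections [f : I + J -> [1, p]] that restrict on [I] to an element of [g * W]
   are counted in two ways: choosing [f] on [I], then freely on [J], gives
   [#|restr_W| * (p - #|I|) ^_ #|J|], while they are the fibers, of size
   [#|restr_V|], of a map onto the points of [g * W * x0] fixed by [Sp p]. In the
   application [e] enumerates a support of [W] on [I], and the rest of a support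
   [E] of [x0] on [J]. *)
Section Slice.
Variables (X : finitary_set) (x0 : X) (W : set Sinf) (E : set Omega).
Variables (I J : finType) (e : I + J -> Omega).
Hypotheses (W1 : W 1%g) (WM : forall u v, W u -> W v -> W (u * v)%g)
  (WV : forall u, W u -> W u^-1%g).
Hypothesis e_inj : injective e.
Hypothesis W_inl : forall w i, W w -> exists i', w (e (inl i)) = e (inl i').
Hypothesis W_fix : forall u : Sinf, (forall i, u (e (inl i)) = e (inl i)) -> W u.
Hypothesis E_fin : finite_set E.
Hypothesis E_fix : forall u : Sinf, (forall z, E z -> u z = z) -> act u x0 = x0.
Hypothesis E_stab : forall (u : Sinf) z, act u x0 = x0 -> E z -> E (u z).
Hypothesis E_inr : forall j, E (e (inr j)).
Hypothesis E_cover : forall z, E z -> exists s, e s = z.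

(** [W] may be infinite; recording only the maps it induces on the indices gives a finite set to
    count with. *)
Definition restr_W : {set {ffun I -> I}} :=
  [set a : {ffun I -> I} |
    `[< exists2 w, W w & forall i, w (e (inl i)) = e (inl (a i)) >]].

Definition restr_V : {set {ffun I + J -> I + J}} :=
  [set a : {ffun I + J -> I + J} | `[< exists2 v : Sinf, W v /\ act v x0 = x0 &
    forall s, v (e s) = e (a s) >]].

Lemma restr_W_gt0 : (0 < #|restr_W|)%N.
Proof.
apply/card_gt0P; exists [ffun i => i]; rewrite inE; apply/asboolP.
by exists 1%g => // i; rewrite ffunE.
Qed.

Lemma restr_V_gt0 : (0 < #|restr_V|)%N.
Proof.
apply/card_gt0P; exists [ffun i => i]; rewrite inE; apply/asboolP.
by exists 1%g => [|i]; [rewrite act1|rewrite ffunE].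
Qed.

Lemma act_eqP (u v : Sinf) : act u x0 = act v x0 <-> act (u^-1 * v)%g x0 = x0.
Proof.
split=> [uv|e1]; first by rewrite actM -uv -actM mulVg act1.
by rewrite -[in LHS]e1 -actM mulVKg.
Qed.

Lemma act_eq_on (u v : Sinf) :
  (forall s, u (e s) = v (e s)) -> act u x0 = act v x0.
Proof.
move=> uv; apply/act_eqP/E_fix => z /E_cover[s <-].
by rewrite sinf_mulE -uv sinf_mulVE.
Qed.

Variables (g : Sinf) (p : nat).
Hypothesis g_le : forall i, (val (g (e (inl i))) <= p)%N.

Definition omega_of (i : 'I_p) : Omega := exist _ i.+1 isT.

Lemma omega_of_inj : injective omega_of.
Proof. by move=> i j [ij]; exact: val_inj. Qed.

Lemma omega_of_le i : (val (omega_of i) <= p)%N.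
Proof. exact: ltn_ord. Qed.

Lemma omega_ofP (z : Omega) : (val z <= p)%N -> exists i, omega_of i = z.
Proof.
case: z => [[//|z] z0] /= zp; exists (Ordinal zp).
by apply: val_inj.
Qed.

Definition lift_of (f : {ffun I + J -> 'I_p}) : set Sinf :=
  [set w | W w /\ forall s, g (w (e s)) = omega_of (f s)].

Definition slice_maps : {set {ffun I + J -> 'I_p}} :=
  [set f : {ffun I + J -> 'I_p} | `[< exists w, lift_of f w >]].

Definition lifting (f : {ffun I + J -> 'I_p}) : Sinf := xget 1%g (lift_of f).

Lemma slice_mapsP f w : lift_of f w -> f \in slice_maps.
Proof. by move=> fw; rewrite inE; apply/asboolP; exists w. Qed.

Lemma liftP f : f \in slice_maps -> lift_of f (lifting f).
Proof. by rewrite inE => /asboolP; exact: xgetPex. Qed.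

Lemma slice_map_inj f : f \in slice_maps -> injective f.
Proof.
move=> /liftP[_ fE] s u fsu; apply/e_inj/(@sinf_inj (lifting f))/(@sinf_inj g).
by rewrite !fE fsu.
Qed.

(* A finite set of points stable under [Sp p] lies in [[1, p]], as a point beyond
   [p] has an infinite [Sp p]-orbit. *)
Lemma Sp_stable_le (A : set Omega) : finite_set A ->
  (forall u, Sp p u -> forall z, A z -> A (u z)) ->
  forall z, A z -> (val z <= p)%N.
Proof.
move=> A_fin A_stab z Az; rewrite leqNgt; apply/negP => pz.
have [z' [z'A /=]] : (~` A `&` [set x | (p < val x)%N]) !=set0.
  apply: infinite_setN0; rewrite setIC -setDE; apply: infinite_setD => //.
  rewrite -[X in infinite_set X]setCK.
  apply: cofinite_set_infinite Omega_infinite _; rewrite setCK.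
  apply: (@sub_finite_set _ _ (range omega_of)).
    by move=> x /= /negP; rewrite -leqNgt => /omega_ofP[i <-]; exists i.
  exact/finite_image/finite_finset.
move=> pz'.
(* The transposition of [z] and [z'], both beyond [p], lies in [Sp p] and moves [z] out of [A]. *)
pose h x := if x == z then z' else if x == z' then z else x.
have hK : involutive h.
  move=> x; rewrite /h; have [->|xz] := eqVneq x z.
    by rewrite eqxx; case: eqP.
  by have [->|xz'] := eqVneq x z'; rewrite ?eqxx // (negPf xz) (negPf xz').
apply: z'A; rewrite -[z'](_ : MkSinf hK hK z = _); last by rewrite /= /h eqxx.
apply: A_stab => // x /= xp; rewrite /h.
by do 2![case: eqP => [xE|_]; first by move: xp; rewrite xE leqNgt ?pz ?pz'].
Qed.


(** If [Sp p] fixes [g * w * x0], then the translated support [g * w * E] lies in [[1, p]], so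
    [g * w] restricts to a map [f] into [[1, p]]; this [f] determines the point, since the image of
    [e] contains [E]. *)
Lemma slice_fixed :
  fixed_pts [set act (g * w)%g x0 | w in W] p =
  (fun f => act (g * lifting f)%g x0) @` [set` slice_maps].
Proof.
apply/seteqP; split=> x /=.
  move=> [[w Ww <-] fix_w].
  have gwE : forall z, E z -> (val (g (w z)) <= p)%N.
    suff H : forall z, ((g * w)%g @` E) z -> (val z <= p)%N.
      by move=> z Ez; apply: H; exists z.
    apply: Sp_stable_le; first exact: finite_image.
    move=> u pu _ [z Ez <-].
    (* The conjugate of [u] by [g * w] fixes [x0], hence preserves [E]. *)
    exists (((g * w)^-1 * (u * (g * w)))%g z); last first.
      by rewrite -[LHS]sinf_mulE mulVKg.
    apply: E_stab => //; apply/act_eqP.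
    by rewrite [RHS]actM fix_w.
  have /choice[f fE] s : exists i, omega_of i = g (w (e s)).
    apply: omega_ofP; case: s => [i|j]; last exact: gwE.
    by have [i' ->] := W_inl i Ww.
  have fw : lift_of [ffun s => f s] w by split=> // s; rewrite ffunE fE.
  exists [ffun s => f s]; first exact: slice_mapsP fw.
  apply: act_eq_on => s; rewrite !sinf_mulE.
  have [_ ->] := liftP (slice_mapsP fw).
  by have [_ ->] := fw.
move=> [f /liftP[Wf fE] <-]; split; first by exists (lifting f).
move=> u pu; rewrite -actM; apply: act_eq_on => s.
by rewrite !sinf_mulE fE pu //=; exact: omega_of_le.
Qed.

(** The maps giving the same point as [f] are the [f \o a] with [a] in [restr_V], induced by the
    quotient of the two liftings; they are distinct because [f] is injective. *)
Lemma slice_fiber f : f \in slice_maps ->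
  #|[set f' in slice_maps |
     `[< act (g * lifting f')%g x0 = act (g * lifting f)%g x0 >]]| = #|restr_V|.
Proof.
move=> fP; have [Wf fE] := liftP fP.
pose comp (a : {ffun I + J -> I + J}) := [ffun s => f (a s)].
have comp_inj : injective comp.
  move=> a b /ffunP ab; apply/ffunP => s; apply: (slice_map_inj fP).
  by have := ab s; rewrite !ffunE.
rewrite -(card_imset _ comp_inj); apply: eq_card => f'; rewrite inE.
apply/andP/imsetP => [[f'P /asboolP e']|[a]].
  have [Wf' f'E] := liftP f'P.
  pose v := ((lifting f)^-1 * lifting f')%g.
  have Wv : W v by apply: WM => //; exact: WV.
  have vx0 : act v x0 = x0.
    by have /esym/act_eqP := e'; rewrite invgM -mulgA mulKg.
  have /choice[a aE] s : exists s', e s' = v (e s).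
    case: s => [i|j]; first by have [i' ->] := W_inl i Wv; exists (inl i').
    exact/E_cover/E_stab.
  exists (finfun a).
    by rewrite inE; apply/asboolP; exists v => // s; rewrite ffunE aE.
  apply/ffunP => s; rewrite ffunE ffunE; apply: omega_of_inj.
  by rewrite -f'E -fE aE /v sinf_mulE sinf_mulEV.
rewrite inE => /asboolP[v [Wv vx0] vE] ->.
have fvP : lift_of (comp a) (lifting f * v)%g.
  by split=> [|s]; [exact: WM|rewrite ffunE sinf_mulE vE fE].
have f'P := slice_mapsP fvP; split => //; apply/asboolP.
have [_ f'E] := liftP f'P.
rewrite [RHS](_ : _ = act (g * (lifting f * v))%g x0); last by rewrite !actM vx0.
by apply: act_eq_on => s; rewrite sinf_mulE f'E -(fvP.2).
Qed.

(** With [c] the map induced by [g] on [I], an element of [slice_maps] is [c \o a] on [I] for some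
    [a] in [restr_W], together with an arbitrary injection of [J] into the values missed by [c]. *)
Lemma card_slice_maps :
  #|slice_maps| = (#|restr_W| * (p - #|I|) ^_ #|J|)%N.
Proof.
have /choice[c cE] i : exists i', omega_of i' = g (e (inl i)) by exact: omega_ofP.
have c_inj : injective c.
  move=> i i' cii'; have : g (e (inl i)) = g (e (inl i')) by rewrite -!cE cii'.
  by move=> /(@sinf_inj g)/e_inj[].
pose merge (au : {ffun I -> I} * {ffun J -> 'I_p}) : {ffun I + J -> 'I_p} :=
  [ffun s => match s with inl i => c (au.1 i) | inr j => au.2 j end].
have merge_inj : injective merge.
  move=> [a u] [a' u'] /ffunP auE; congr (_, _); apply/ffunP => i.
    by have := auE (inl i); rewrite !ffunE /= => /c_inj.
  by have := auE (inr i); rewrite !ffunE.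
pose U := [set u : {ffun J -> 'I_p} in ffun_on [predC codom c] | injectiveb u].
have cardU : #|U| = ((p - #|I|) ^_ #|J|)%N.
  rewrite card_inj_ffuns_on; congr (_ ^_ _)%N.
  have := cardC (mem (codom c)); rewrite card_codom // card_ord => pE.
  by rewrite -[p in RHS]pE addKn; apply: eq_card => i; rewrite !inE.
rewrite -cardU -cardsX -(card_imset _ merge_inj); apply: eq_card => f.
apply/idP/imsetP => [fP|[[a u]]].
  have [Wf fE] := liftP fP.
  have /choice[a aE] i := W_inl i Wf.
  have fa i : f (inl i) = c (a i).
    by apply: omega_of_inj; rewrite -fE aE cE.
  exists (finfun a, [ffun j => f (inr j)]); last first.
    by apply/ffunP => -[i|j]; rewrite !ffunE /= ?ffunE.
  have a_inj : injective a.
    move=> i i' aii'; have : f (inl i) = f (inl i') by rewrite !fa aii'.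
    by move=> /(slice_map_inj fP)[].
  rewrite finset.in_setX; apply/andP; split.
    by rewrite inE; apply/asboolP; exists (lifting f) => // i; rewrite ffunE aE.
  rewrite inE; apply/andP; split.
    apply/ffun_onP => j; rewrite ffunE; apply/negP => /codomP[i].
    (* A value [c i] is already taken by [f] at the preimage of [i] under [a]. *)
    rewrite -[i](f_invF a_inj) -fa.
    by move=> /(slice_map_inj fP).
  by apply/injectiveP => j j'; rewrite !ffunE => /(slice_map_inj fP)[].
rewrite finset.in_setX => /andP[/=]; rewrite inE => /asboolP[w Ww wE].
rewrite inE => /andP[/ffun_onP u_on /injectiveP u_inj] fE.
have a_inj : injective a.
  move=> i i' aii'; have : w (e (inl i)) = w (e (inl i')) by rewrite !wE aii'.
  by move=> /(@sinf_inj w)/e_inj[].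
have f_inj : injective f.
  rewrite fE => -[i|j] [i'|j']; rewrite !ffunE /=.
  - by move=> /c_inj/a_inj ->.
  - by move=> cu; have /negP[] := u_on j'; rewrite -cu codom_f.
  - by move=> cu; have /negP[] := u_on j; rewrite cu codom_f.
  - by move=> /u_inj ->.
have [|h hE] := @sinf_extend _ e (omega_of \o f) e_inj.
  exact: inj_comp omega_of_inj f_inj.
(* The lifting is [g^-1 * h]. It lies in [W] because it agrees with [w] on [I], so that
   [w^-1 * (g^-1 * h)] fixes these points. *)
apply: (@slice_mapsP _ (g^-1 * h)%g); split=> [|s]; last first.
  by rewrite sinf_mulE sinf_mulEV hE.
suff : W (w^-1 * (g^-1 * h))%g by move=> /(WM Ww); rewrite mulVKg.
apply: W_fix => i.
have hi : h (e (inl i)) = g (e (inl (a i))) by rewrite hE /= fE ffunE /= cE.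
by rewrite !sinf_mulE hi sinf_mulVE -wE sinf_mulVE.
Qed.

Lemma slice_count : exists2 m : nat,
  fixed_pts [set act (g * w)%g x0 | w in W] p #= `I_m &
  (m * #|restr_V| = #|restr_W| * (p - #|I|) ^_ #|J|)%N.
Proof.
rewrite slice_fixed -card_slice_maps.
exact: (@fiber_count _ _ _ (fun f => act (g * lifting f)%g x0) _ slice_fiber).
Qed.

End Slice.

(** * Measures of slices and traces supported on one orbit *)

(** The last condition, with finiteness, forces [g * E] into [[1, p]] as soon as [Sp p] fixes
    [g * x0]. *)
Definition stab_support (X : finitary_set) (x0 : X) (E : set Omega) : Prop :=
  [/\ finite_set E,
      forall u : Sinf, (forall z, E z -> u z = z) -> act u x0 = x0 &
      forall (u : Sinf) z, act u x0 = x0 -> E z -> E (u z)].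

Section Trace.
Variables (k : fieldType) (t : k).
Hypothesis k_char0 : [pchar k] =i pred0.

Lemma integral_indic (X : finitary_set) (B : set X) (f : X -> k) (c : k) :
  B !=set0 -> (forall x, B x -> f x = c) -> (forall x, ~ B x -> f x = 0) ->
  integral t f = c * mu t B.
Proof.
move=> [b Bb] fB fNB; have fE x : f x = c \/ f x = 0.
  by have [/fB|/fNB] := pselect (B x); [left|right].
rewrite /integral -(@fsbig_widen _ _ _ _ [set c]); last first.
- by move=> a [[x _ <-] /= fxc]; have [//|->] := fE x; rewrite mul0r.
- by move=> _ ->; exists b => //; exact: fB.
(* For [c = 0] the preimage of [c] may exceed [B], but both sides vanish. *)
rewrite fsbig_set1; have [->|c0] := eqVneq c 0; first by rewrite !mul0r.
congr (_ * mu t _); apply/seteqP; split=> x /=; last exact: fB.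
move=> fxc; apply: contrapT => /fNB fx0.
by move: c0; rewrite -fxc fx0 eqxx.
Qed.

(** [slice_count] with [I] enumerating [D] and [J] enumerating the rest of [E]: the polynomial is a
    falling factorial of length [s - d] shifted by [d]. Its coefficient is a quotient of orders of
    two restriction groups, hence nonzero and independent of [g]. *)
Lemma mu_slice (X : finitary_set) (x0 : X) (E : set Omega) (W : set Sinf)
    (D : set Omega) (d s : nat) :
  W 1%g -> (forall u v, W u -> W v -> W (u * v)%g) ->
  (forall u, W u -> W u^-1%g) ->
  (forall w z, W w -> D z -> D (w z)) ->
  (forall u : Sinf, (forall z, D z -> u z = z) -> W u) ->
  stab_support x0 E -> D #= `I_d -> D `|` E #= `I_s ->
  exists2 rho : k, rho != 0 & forall g,
    mu t [set act (g * w)%g x0 | w in W] = rho * \prod_(d <= i < s) (t - i%:R).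
Proof.
move=> W1 WM WV W_stab W_fix [E_fin E_fix E_stab] Dd DEs.
have D_fin : finite_set D by apply/finite_setP; exists d.
have ED_fin : finite_set (E `\` D) by exact: finite_setD.
pose I := fset_set D : finType; pose J := fset_set (E `\` D) : finType.
pose e (s : I + J) := match s with inl i => val i | inr j => val j end.
have DP (i : I) : D (val i) by move: (valP i); rewrite in_fset_set // inE.
have EP (j : J) : (E `\` D) (val j).
  by move: (valP j); rewrite in_fset_set // inE.
have e_inj : injective e.
  move=> [i|j] [i'|j'] /= eij.
  - by congr inl; exact: val_inj.
  - by have [_] := EP j'; rewrite -[val j']eij => /(_ (DP i)).
  - by have [_] := EP j; rewrite [val j]eij => /(_ (DP i')).
  - by congr inr; exact: val_inj.
have eD z : D z -> exists i, e (inl i) = z.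
  move=> Dz; have zI : z \in fset_set D by rewrite in_fset_set // inE.
  by exists [` zI]%fset.
have eE z : E z -> exists s, e s = z.
  move=> Ez; have [/eD[i <-]|nDz] := pselect (D z); first by exists (inl i).
  have zJ : z \in fset_set (E `\` D) by rewrite in_fset_set // inE.
  by exists (inr [` zJ]%fset).
have cI : #|I| = d by rewrite -cardfE; exact: card_fset_set.
have cIJ : (d + #|J| = s)%N.
  rewrite -cI -card_sum; apply/card_eq_II; apply: card_eq_trans DEs.
  have -> : D `|` E = [set` codom e].
    apply/seteqP; split=> z /=.
      by case=> [/eD[i <-]|/eE[u <-]]; exact: codom_f.
    by move=> /codomP[[i|j] ->]; [left; exact: DP|right; exact: (EP j).1].
  rewrite card_eq_sym -(size_codom e); apply: card_seq.
  by rewrite map_inj_uniq ?enum_uniq.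
pose KW := #|restr_W W e|; pose KV := #|restr_V x0 W e|.
have KW0 : (0 < KW)%N by exact: restr_W_gt0.
have KV0 : (0 < KV)%N by exact: restr_V_gt0.
exists (ratr (KW%:R / KV%:R)).
  rewrite -[ratr _]/(ratr_char0 k_char0 _) fmorph_eq0.
  by rewrite mulf_neq0 ?invr_eq0 // Num.Theory.pnatr_eq0 -lt0n.
move=> g.
have -> : \prod_(d <= i < s) (t - i%:R) = \prod_(i < #|J|) (t - (d + i)%:R).
  rewrite -{1}[d]add0n big_addn -cIJ addKn big_mkord.
  by apply: eq_bigr => i _; rewrite addnC.
(* From this bound on, [[1, p]] contains [g * D]. *)
apply: mu_ffact => //; exists (\max_(i : I) val (g (e (inl i))))%N => p gp.
have g_le i : (val (g (e (inl i))) <= p)%N.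
  by apply: leq_trans gp; exact: (leq_bigmax i).
have W_inl w i : W w -> exists i', w (e (inl i)) = e (inl i').
  by move=> Ww; have [i' <-] := eD _ (W_stab _ _ Ww (DP i)); exists i'.
have W_fix' (u : Sinf) : (forall i, u (e (inl i)) = e (inl i)) -> W u.
  by move=> ue; apply: W_fix => z /eD[i <-].
have [m mP mE] := slice_count WM WV e_inj W_inl W_fix' E_fin E_fix E_stab
  (fun j => (EP j).1) eE g_le.
exists m => //; rewrite hornerZ ffact_polyE; last first.
  (* [d <= p], as the [d] distinct points of [g * D] lie in [[1, p]]. *)
  rewrite -cI; have /choice[c cE] i := omega_ofP (g_le i).
  rewrite -[p in (_ <= p)%N]card_ord; apply: (@leq_card _ _ c) => i i' cii'.
  have : g (e (inl i)) = g (e (inl i')) by rewrite -!cE cii'.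
  by move=> /(@sinf_inj g)/e_inj[].
rewrite mulrAC -natrM -cI -mE natrM mulfK //.
by rewrite Num.Theory.pnatr_eq0 -lt0n.
Qed.

Definition pair_orbit (X Y : finitary_set) (x0 : X) (y0 : Y) : Y -> X -> Prop :=
  fun y x => exists s, y = act s y0 /\ x = act s x0.

(** The slice of the orbit over [g * y0] is [g * W * x0], where [W] is the stabilizer of [y0]. Its
    measure does not depend on [g], so the inner integral is constant and the outer one multiplies
    it by the measure of [Y]. *)
Lemma trace_orbit (X Y : finitary_set) (x0 : X) (y0 : Y) (D E : set Omega)
    (s : nat) :
  (forall y, exists g, y = act g y0) ->
  stab_support x0 E -> stab_support y0 D -> D `|` E #= `I_s ->
  exists2 rho : k, rho != 0 & forall (h : Y -> X -> k) (c : k),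
    (forall y x, h y x = (`[< pair_orbit x0 y0 y x >])%:R * c) ->
    integral t (fun y => integral t (h y)) =
    rho * c * \prod_(0 <= i < s) (t - i%:R).
Proof.
move=> transY suppE suppD DEs; have [D_fin D_fix D_stab] := suppD.
have [d Dd] := (finite_setP D).1 D_fin.
have ds : (d <= s)%N.
  rewrite -card_le_II -(card_le_eql Dd) -(card_le_eqr DEs).
  by apply: subset_card_le; left.
pose W := [set u | act u y0 = y0].
have W1 : W 1%g by exact: act1.
have WM u v : W u -> W v -> W (u * v)%g.
  by move=> Wu Wv; rewrite /W /= actM Wv.
have WV u : W u -> W u^-1%g.
  by move=> Wu; rewrite /W /= -{1}Wu -actM mulVg act1.
have [rX rX0 muX] := mu_slice W1 WM WV D_stab D_fix suppE Dd DEs.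
(* The whole of [Y] is the slice for the full group with empty [D]. *)
have [rY rY0 muY] : exists2 rY : k, rY != 0 & forall g,
    mu t [set act (g * w)%g y0 | w in [set: Sinf]] =
    rY * \prod_(0 <= i < d) (t - i%:R).
  apply: (@mu_slice _ _ D _ set0) => //; last by rewrite set0U.
  by rewrite II0; exact: card_eq00.
exists (rX * rY) => [|h c hE]; first exact: mulf_neq0.
pose C := c * (rX * \prod_(d <= i < s) (t - i%:R)).
have intX y : integral t (h y) = C.
  have [g ->] := transY y; rewrite /C -(muX g).
  apply: integral_indic; first by exists (act (g * 1)%g x0); exists 1%g.
    move=> _ [w Ww <-]; rewrite hE asboolT ?mul1r //.
    by exists (g * w)%g; rewrite actM Ww.
  move=> x nx; rewrite hE asboolF ?mul0r // => -[u [ey ex]]; apply: nx.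
  exists (g^-1 * u)%g; last by rewrite mulVKg.
  by rewrite /W /= actM -ey -actM mulVg act1.
have -> : (fun y => integral t (h y)) = fun=> C by apply/funext => y; exact: intX.
have -> : integral t (fun _ : Y => C) = C * mu t [set: Y].
  by apply: integral_indic => [|//|x /(_ I)//]; exists y0.
rewrite [mu _ _](_ : _ = rY * \prod_(0 <= i < d) (t - i%:R)); last first.
  rewrite -(muY 1%g); congr (mu t _); apply/seteqP; split=> // y _.
  by have [g ->] := transY y; exists g; rewrite // mul1g.
by rewrite (big_cat_nat (leq0n d) ds) /= /C; ring.
Qed.

End Trace.

Lemma nat_partK (k : fieldType) (x : k) :
  (exists m : nat, x = m%:R) -> (nat_part x)%:R = x.
Proof.
move=> [m xm]; rewrite /nat_part; case: pselect => [ex_x|[]]; last first.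
  by exists m; apply/eqP.
by case: ex_minnP => p /eqP.
Qed.

(** * Blocks as the fibers of a colouring, and supports of cosets *)

Section Colour.
Variables (k : fieldType) (t : k) (n : option Omega) (beta : Lambda t n).

Let i1 := idx1 n.

Lemma idx_ge2 (i : idx n) : i != i1 -> (2 <= val i)%N.
Proof.
move=> ni; rewrite ltn_neqAle andbC; move: (valP i) => /andP[-> _] /=.
by apply: contra ni => /eqP e; apply/eqP/val_inj.
Qed.

Lemma block_tailE (i : idx n) z : i != i1 ->
  let a := (\sum_(2 <= l < val i) entry beta l)%N in
  block_tail beta i z = (a < val z <= a + nat_part (beta i))%N.
Proof.
move=> /idx_ge2 i2 /=; rewrite /block_tail /= big_nat_recr //=.
by rewrite [entry beta (sval i)]/entry valK add1n.
Qed.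

(** For [i < j], the sum ending block [i] is an initial part of the sum after which block [j]
    starts. *)
Lemma block_tail_disjoint (i j : idx n) z :
  i != i1 -> j != i1 -> block_tail beta i z -> block_tail beta j z -> i = j.
Proof.
wlog ij : i j / (val i <= val j)%N.
  move=> H ni nj bi bj; have [ij|ji] := orP (leq_total (val i) (val j)).
    exact: H.
  exact/esym/H.
move=> ni nj /andP[_ zi] /andP[zj _]; apply/val_inj/eqP; rewrite eqn_leq ij /=.
rewrite leqNgt; apply/negP => lt_ij.
have := leq_trans zj zi; rewrite add1n ltnNge => /negP; apply.
rewrite [leqRHS](big_cat_nat (n := (val i).+1)) ?leq_addr //.
exact/leqW/idx_ge2.
Qed.

Lemma block_uniq (i j : idx n) z : block beta i z -> block beta j z -> i = j.
Proof.
rewrite /block; case: (eqVneq i) => [->|ni]; case: (eqVneq j) => [->|nj] //.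
- by move=> nz zj; case: nz; exists j.
- by move=> zi nz; case: nz; exists i.
- exact: block_tail_disjoint.
Qed.

Lemma block_ex z : exists i, block beta i z.
Proof.
have [[j nj jz]|nz] :=
    pselect ((\bigcup_(j in [set j | j != i1]) block_tail beta j) z).
  by exists j; rewrite /block (negPf nj).
by exists i1; rewrite /block eqxx.
Qed.

Definition colour (z : Omega) : idx n := sval (cid (block_ex z)).

Lemma blockP i z : block beta i z <-> colour z = i.
Proof.
have cz := svalP (cid (block_ex z)); split=> [zi|<-//].
exact: block_uniq cz zi.
Qed.

Lemma blockE i : block beta i = colour @^-1` [set i].
Proof. by apply/seteqP; split=> z /=; rewrite blockP. Qed.

Lemma card_colour i : i != i1 ->
  colour @^-1` [set i] #= `I_(nat_part (beta i)).
Proof.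
move=> ni; rewrite -blockE /block (negPf ni).
set a := (\sum_(2 <= l < val i) entry beta l)%N.
pose f j : Omega := exist _ (a + j).+1 isT.
have f_inj : {in `I_(nat_part (beta i)) &, injective f}.
  by move=> x y _ _ [/addnI].
rewrite -(card_eqr (inj_card_eq f_inj)) card_eq_sym.
suff -> : f @` `I_(nat_part (beta i)) = block_tail beta i by exact: card_eqxx.
apply/seteqP; split=> z; rewrite block_tailE // -/a.
  by move=> [j /= jm <-] /=; rewrite ltnS leq_addr -addnS leq_add2l.
move=> /andP[az za]; exists (val z - a.+1)%N => /=.
  by rewrite -subSn // subSS leq_subLR.
by apply: val_inj; rewrite /= -addSn subnKC.
Qed.

Lemma colour_finite : finite_set [set z | colour z <> i1].
Proof.
apply: sub_finite_set (block_tails_finite beta) => z nz.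
have := (blockP (colour z) z).2 erefl; rewrite /block; case: eqP => // _ zz.
by exists (colour z) => //=; apply/eqP.
Qed.

Lemma youngP s : young beta s <-> forall z, colour (s z) = colour z.
Proof.
split=> [ys z|ys i].
  apply/blockP; rewrite -(ys (colour z)); exists z => //; exact/blockP.
rewrite blockE; apply/seteqP; split=> [_ [z /= <- <-]|z /= <-]; first exact: ys.
by exists ((s^-1)%g z); rewrite /= ?sinf_mulEV // -ys sinf_mulEV.
Qed.

Local Notation pt s := (coset_of (Young beta) s : Xset beta).

Lemma coset_eqP (s u : Sinf) : pt s = pt u <-> young beta (s^-1 * u)%g.
Proof.
split=> [/(congr1 sval) /= su|yu]; last first.
  by rewrite -[u in RHS](mulVKg s) coset_of_mulr.
have : lcos u (Young beta) u by exists 1%g; [exact: young1|rewrite mulg1].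
by rewrite -su => -[a ya <-]; rewrite mulKg.
Qed.

Lemma coset_transitive (s : Sinf) (x : Xset beta) : exists g, x = act g (pt s).
Proof.
have [u ->] := coset_ofP x; exists (u * s^-1)%g.
by rewrite [RHS]coset_actE mulgVK.
Qed.

(** The support is the image under [s] of the finitely many points of colour other than 1; the
    stabilizer of the coset preserves the transported colouring. *)
Lemma support_coset (s : Sinf) :
  stab_support (pt s) [set z | colour ((s^-1)%g z) <> i1].
Proof.
have actP (u : Sinf) : act u (pt s) = pt s <->
    forall z, colour ((s^-1)%g (u (s z))) = colour z.
  rewrite [act _ _]coset_actE; split.
    move=> /esym/coset_eqP/youngP H z; by rewrite -[RHS]H.
  by move=> H; apply/esym/coset_eqP/youngP => z; rewrite -[RHS]H.
split.
- apply: (@sub_finite_set _ _ (s @` [set z | colour z <> i1])).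
    by move=> z /= nz; exists ((s^-1)%g z); rewrite ?sinf_mulEV.
  exact/finite_image/colour_finite.
- move=> u uE; apply/actP => z.
  have [z1|nz] := pselect (colour z = i1); last first.
    have nE : colour ((s^-1)%g (s z)) <> i1 by rewrite sinf_mulVE.
    by rewrite (uE _ nE) sinf_mulVE.
  have [->|nu] := pselect (colour ((s^-1)%g (u (s z))) = i1); first by rewrite z1.
  (* Now [u (s z)] lies in the support, so [u] fixes it; injectivity gives [u (s z) = s z]. *)
  by have /(@sinf_inj u) -> := uE _ nu; rewrite sinf_mulVE.
- move=> u z /actP us; have := us ((s^-1)%g z).
  by rewrite sinf_mulEV /mkset => ->.
Qed.

End Colour.

(** * Permutations realizing the matrix [q], and the size of the joint support *)

Section Matching.
Variables (k : fieldType) (t : k) (n : option Omega) (beta delta : Lambda t n).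
Variable q : Mat delta beta.
Hypothesis k_char0 : [pchar k] =i pred0.

Let i1 := idx1 n.
Let p1 : idx n * idx n := (i1, i1).

Definition cells : seq (idx n * idx n) :=
  fset_set ([set ij : idx n * idx n | q ij.1 ij.2 != 0] `\ p1).

Lemma mem_cells ij : (ij \in cells) = (ij != p1) && (q ij.1 ij.2 != 0).
Proof.
rewrite /cells in_fset_set; last exact/finite_setD/(mat_finite q).
by apply/idP/andP; rewrite inE => -[/= ? /eqP ?]; split => //=; exact/eqP.
Qed.

Lemma cells_uniq : uniq cells. Proof. exact: fset_uniq. Qed.

Lemma mat_nat_partK ij : ij != p1 -> (nat_part (q ij.1 ij.2))%:R = q ij.1 ij.2.
Proof. by case: ij => i j nij; apply/nat_partK/(mat_tail q). Qed.

(** Each cell other than [(1, 1)] is repeated as often as its entry says, which turns sums of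
    entries into counts. *)
Definition cell_list : seq (idx n * idx n) :=
  flatten [seq nseq (nat_part (q ij.1 ij.2)) ij | ij <- cells].

Lemma count_cell_list (P : pred (idx n * idx n)) :
  count P cell_list = (\sum_(ij <- cells | P ij) nat_part (q ij.1 ij.2))%N.
Proof.
rewrite /cell_list count_flatten -map_comp sumnE big_map [RHS]big_mkcond.
by apply: eq_bigr => ij _; rewrite /= count_nseq; case: (P ij); rewrite ?mul1n.
Qed.

Lemma cell_list_head : p1 \notin cell_list.
Proof.
by rewrite -has_pred1 has_count count_cell_list big1_seq // => ij /andP[/eqP->];
  rewrite mem_cells eqxx.
Qed.

Lemma natr_count_cell_list (P : pred (idx n * idx n)) :
  (count P cell_list)%:R = \sum_(ij <- cells | P ij) q ij.1 ij.2.
Proof.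
rewrite count_cell_list natr_sum big_seq_cond [RHS]big_seq_cond.
apply: eq_bigr => ij /andP[+ _]; rewrite mem_cells => /andP[nij _].
exact: mat_nat_partK.
Qed.

Lemma count_cell ij : ij != p1 -> count_mem ij cell_list = nat_part (q ij.1 ij.2).
Proof.
move=> nij; apply: (natr_inj_char0 k_char0).
rewrite natr_count_cell_list mat_nat_partK // (bigfs _ cells_uniq); last first.
  by move=> _ /eqP ->; rewrite mem_cells nij negbK => /eqP.
rewrite (_ : [set` _] = [set ij]) ?fsbig_set1 //.
by apply/seteqP; split=> u /= /eqP.
Qed.

(** A row other than the first avoids the cell [(1, 1)], so [cells] omits only zero entries of it.
    The equality is proved in [k], where the row sum is given, and descends to integers by
    characteristic zero. *)
Lemma count_row i : i != i1 ->
  count (fun ij => ij.1 == i) cell_list = nat_part (delta i).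
Proof.
move=> ni; apply: (natr_inj_char0 k_char0).
rewrite natr_count_cell_list (nat_partK (lam_tail delta ni)) -(mat_row q i).
rewrite (bigfs _ cells_uniq); last first.
  move=> ij /eqP ij_i; rewrite mem_cells negb_and !negbK => /orP[/eqP e|/eqP//].
  by move: ni; rewrite -ij_i e eqxx.
apply: (@reindex_fsbig _ _ _ _ _ (fun j => (i, j))); split.
- by move=> j _; exact: eqxx.
- by move=> j j' _ _ [].
- by move=> [i' j] /= /eqP <-; exists j.
Qed.

Lemma count_col j : j != i1 ->
  count (fun ij => ij.2 == j) cell_list = nat_part (beta j).
Proof.
move=> nj; apply: (natr_inj_char0 k_char0).
rewrite natr_count_cell_list (nat_partK (lam_tail beta nj)) -(mat_col q j).
rewrite (bigfs _ cells_uniq); last first.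
  move=> ij /eqP ij_j; rewrite mem_cells negb_and !negbK => /orP[/eqP e|/eqP//].
  by move: nj; rewrite -ij_j e eqxx.
apply: (@reindex_fsbig _ _ _ _ _ (fun i => (i, j))); split.
- by move=> i _; exact: eqxx.
- by move=> i i' _ _ [].
- by move=> [i j'] /= /eqP <-; exists i.
Qed.

(** All entries sum to [t], and [(1, 1)] is the only omitted cell whose entry may be nonzero. *)
Lemma size_cell_list : (size cell_list)%:R = t - q i1 i1.
Proof.
rewrite -count_predT natr_count_cell_list; apply/esym/eqP; rewrite subr_eq.
rewrite -[eqbLHS](mat_sum q) (@fsbigE _ _ _ _ _ (p1 :: cells)) //=.
- rewrite big_cons [eqbRHS]addrC in_setT (eq_bigl xpredT) // => ij.
  by rewrite in_setT.
- by rewrite mem_cells eqxx cells_uniq.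
- move=> ij _; rewrite inE mem_cells negb_or => /andP[->] /=.
  by rewrite negbK => /eqP.
Qed.

(* A colouring by pairs with [q i j] points in each cell [(i, j)] but [(1, 1)].
   Matching its two projections with the colourings given by [delta] and [beta]
   produces an [s] with [matches q s]. *)
Definition model (z : Omega) : idx n * idx n := nth p1 cell_list (val z).-1.

Lemma card_model (P : pred (idx n * idx n)) : ~~ P p1 ->
  [set z | P (model z)] #= `I_(count P cell_list).
Proof.
move=> nP; pose f i : Omega := exist _ i.+1 isT.
pose r := [seq i <- iota 0 (size cell_list) | P (nth p1 cell_list i)].
have -> : count P cell_list = size r.
  by rewrite size_filter -[in LHS](mkseq_nth p1 cell_list) count_map.
have f_inj : {in [set` r] &, injective f} by move=> x y _ _ [].
suff -> : [set z | P (model z)] = f @` [set` r].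
  apply: card_eq_trans (inj_card_eq f_inj) (card_seq _).
  exact/filter_uniq/iota_uniq.
apply/seteqP; split=> [[[//|z] z0]|_ [i /= + <-]] /=; last first.
  by rewrite mem_filter => /andP[].
rewrite /model /= => Pz; exists z; last exact: val_inj.
rewrite /= mem_filter Pz mem_iota /= add0n ltnNge; apply/negP => ge_z.
(* Past the end of the list [nth] returns [p1], which [P] rejects. *)
by move: Pz; rewrite nth_default // (negPf nP).
Qed.

Lemma model_finite : finite_set [set z | model z <> p1].
Proof.
apply/finite_setP; exists (count (predC1 p1) cell_list).
rewrite (_ : [set z | model z <> p1] = [set z | predC1 p1 (model z)]).
  by apply: card_model; apply/negPn/eqP.
by apply/seteqP; split=> z /= /eqP.
Qed.

Definition pair_colour (s : Sinf) (z : Omega) : idx n * idx n :=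
  (colour delta z, colour beta ((s^-1)%g z)).

Lemma cell_fiber (s : Sinf) i j :
  block delta i `&` (s @` block beta j) = pair_colour s @^-1` [set (i, j)].
Proof.
rewrite !blockE; apply/seteqP; split=> z /=.
  by move=> [<- [x /= <- <-]]; rewrite /pair_colour sinf_mulVE.
move=> [<- <-]; split => //; exists ((s^-1)%g z) => //.
exact: sinf_mulEV.
Qed.

Lemma fiber_model ij : ij != p1 ->
  model @^-1` [set ij] #= `I_(nat_part (q ij.1 ij.2)).
Proof.
move=> nij; rewrite -count_cell //.
rewrite (_ : model @^-1` [set ij] = [set z | pred1 ij (model z)]).
  by apply: card_model; rewrite /= eq_sym.
by apply/seteqP; split=> z /= /eqP.
Qed.

Lemma matches_ex : exists s, matches q s.
Proof.
have recol (c : idx n * idx n -> idx n) (lambda : Lambda t n) : c p1 = i1 ->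
    (forall i, i != i1 ->
      count (fun ij => c ij == i) cell_list = nat_part (lambda i)) ->
    exists h : Sinf, forall z, colour lambda (h z) = c (model z).
  move=> cp1 cE; apply: (@recolor_cofinite _ (c \o model) _ i1).
  - apply: sub_finite_set model_finite => z /= ncz mz.
    by apply: ncz; rewrite mz.
  - exact: colour_finite.
  - move=> i /eqP ni; rewrite (card_eqr (card_colour _ ni)) -cE //.
    rewrite (_ : _ @^-1` _ = [set z | (fun ij => c ij == i) (model z)]).
      by apply: card_model; rewrite /= cp1 eq_sym.
    by apply/seteqP; split=> z /= /eqP.
have [a aE] := recol fst delta erefl count_row.
have [b bE] := recol snd beta erefl count_col.
(* [a] and [b] carry the two projections of [model] to the colourings by [delta] and [beta], so the
   pair colour of [a z] for [a * b^-1] is [model z]. *)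
exists (a * b^-1)%g => i j nij; rewrite cell_fiber.
rewrite -(card_eqr (fiber_model nij)).
rewrite (_ : _ @^-1` _ = a @` (model @^-1` [set (i, j)])).
  by apply: inj_card_eq => x y _ _; exact: sinf_inj.
have pcE z : pair_colour (a * b^-1)%g (a z) = model z.
  by rewrite /pair_colour aE invgM invgK sinf_mulE sinf_mulVE bE
    -surjective_pairing.
apply/seteqP; split=> [z /= zE|_ [z /= zE <-]]; last by rewrite /= pcE.
exists ((a^-1)%g z); last exact: sinf_mulEV.
by rewrite /= -pcE sinf_mulEV.
Qed.

(** The union of the supports of the two base points; [1^-1] is kept to match [support_coset] at the
    identity. *)
Lemma pair_colour_support (s : Sinf) :
  [set z | pair_colour s z <> p1] =
  [set z | colour delta ((1 : Sinf)^-1%g z) <> i1] `|`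
  [set z | colour beta ((s^-1)%g z) <> i1].
Proof.
apply/seteqP; split=> z /=.
  by move=> /eqP; rewrite xpair_eqE negb_and => /orP[/eqP|/eqP]; [left|right].
by case=> nz [].
Qed.

(** Away from [p1] the fibers of [model] and [pair_colour s] have equal sizes, so a permutation
    carries one colouring to the other and the count can be made on [model]. *)
Lemma card_matches (s : Sinf) : matches q s ->
  [set z | pair_colour s z <> p1] #= `I_(size cell_list).
Proof.
move=> sM; have [||[i j] /eqP nij|h hE] :=
    @recolor_cofinite _ model (pair_colour s) p1.
- exact: model_finite.
- have [Dfin _ _] := support_coset delta 1%g.
  have [Efin _ _] := support_coset beta s.
  by rewrite pair_colour_support finite_setU.
- apply: card_eq_trans (fiber_model nij) _.
  by rewrite card_eq_sym -cell_fiber; exact: sM.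
have h_inj : {in [set z | model z <> p1] &, injective h}.
  by move=> x y _ _; exact: sinf_inj.
have -> : [set z | pair_colour s z <> p1] = h @` [set z | model z <> p1].
  apply/seteqP; split=> [z /= nz|_ [z /= nz <-]]; last by rewrite /= hE.
  by exists ((h^-1)%g z); rewrite ?sinf_mulEV //= -hE sinf_mulEV.
apply: card_eq_trans (inj_card_eq h_inj) _.
rewrite (_ : [set z | model z <> p1] = [set z | predC1 p1 (model z)]); last first.
  by apply/seteqP; split=> z /= /eqP.
rewrite (_ : size cell_list = count (predC1 p1) cell_list).
  by apply: card_model; apply/negPn/eqP.
apply/esym/eqP; rewrite -all_count; apply/allP => ij ijL.
by apply: contraNneq cell_list_head => <-.
Qed.

End Matching.

(** * Traces against [xi q] and the criterion for negligibility *)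

(** [trace_orbit] is applied twice, with the roles of the two spaces exchanged, and [c] is the value
    of [g] at the base points. The last clause concerns the transpose of [xi q], which serves as
    test morphism. *)
Lemma xi_traces (k : fieldType) (k_char0 : [pchar k] =i pred0) (t : k)
    (n : option Omega) (beta delta : Lambda t n) (q : Mat delta beta) :
  exists s : nat, exists rho1 rho2 : k,
  [/\ s%:R = t - q (idx1 n) (idx1 n), rho1 != 0, rho2 != 0 &
  forall g : Defs.hom k (Xset delta) (Xset beta), exists c : k,
    [/\ tr t (Defs.comp t (xi q) g) = rho1 * c * \prod_(0 <= i < s) (t - i%:R),
        tr t (Defs.comp t g (xi q)) = rho2 * c * \prod_(0 <= i < s) (t - i%:R) &
        (forall x y, g x y = xi q y x) -> c = 1]].
Proof.
pose s := xi_rep q.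
have sM : matches q s by apply: xgetPex; exact: matches_ex.
pose x0 : Xset beta := coset_of (Young beta) s.
pose y0 : Xset delta := coset_of (Young delta) 1%g.
have suppX := support_coset beta s; have suppY := support_coset delta 1%g.
have cardDE := card_matches k_char0 sM.
rewrite pair_colour_support in cardDE.
have [rho1 rho1_0 tr1] :=
  trace_orbit t k_char0 (coset_transitive 1%g) suppX suppY cardDE.
rewrite setUC in cardDE.
have [rho2 rho2_0 tr2] :=
  trace_orbit t k_char0 (coset_transitive s) suppY suppX cardDE.
exists (size (cell_list q)), rho1, rho2; split=> // [|g].
  exact: size_cell_list.
have xiE y x : xi q y x = (`[< pair_orbit x0 y0 y x >])%:R.
  congr (_%:R); congr nat_of_bool; apply: asbool_equiv_eq; split.
    by move=> [u [-> ->]]; exists u.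
  by move=> [u [-> ->]]; exists u.
have hE y x : xi q y x * g x y = (`[< pair_orbit x0 y0 y x >])%:R * g x0 y0.
  rewrite xiE; case: asboolP => [[u [-> ->]]|_]; last by rewrite !mul0r.
  by rewrite hom_inv.
exists (g x0 y0); split.
- exact: tr1 hE.
- apply: tr2 => x y; rewrite mulrC hE; congr (_%:R * _); congr nat_of_bool.
  by apply: asbool_equiv_eq; split=> -[u [e e']]; exists u.
- move=> ->; rewrite xiE asboolT //; exists 1%g; by rewrite !act1.
Qed.

Theorem corollary5p1p2 (k : fieldType) (k_char0 : [pchar k] =i pred0) (t : k)
    (n : option Omega) (beta delta : Lambda t n) (q : Mat delta beta) :
  negligible t (xi q) <->
  (exists m : nat, t = m%:R) /\
  (exists z : int, q (idx1 n) (idx1 n) = z%:~R /\ z < 0).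
Proof.
have [s [rho1 [rho2 [sE rho1_0 rho2_0 trE]]]] := xi_traces k_char0 q.
have negl : negligible t (xi q) <-> \prod_(0 <= i < s) (t - i%:R) = 0.
  split=> [neg|prod0 g]; last first.
    by have [c [-> -> _]] := trE g; rewrite prod0 !mulr0.
  (* Against the transpose of [xi q] the trace is [rho1] times the product, so the product must
     vanish. *)
  pose g : Defs.hom k (Xset delta) (Xset beta) :=
    @Defs.Hom k (Xset delta) (Xset beta) (fun x y => xi q y x)
      (fun u x y => hom_inv (xi q) u y x).
  have [tr1 _] := neg g; have [c [tr1E _ c1]] := trE g.
  move: tr1; rewrite tr1E c1 // mulr1 => /eqP.
  by rewrite mulf_eq0 (negPf rho1_0) => /eqP.
apply: (iff_trans negl).
have qE : q (idx1 n) (idx1 n) = t - s%:R by rewrite sE opprB addrC subrK.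
split=> [/eqP|[[m tm] [z [qz z0]]]].
  rewrite prodf_seq_eq0 => /hasP[i]; rewrite mem_index_iota /= => lt_is.
  rewrite subr_eq0 => /eqP ti; split; first by exists i.
  (* The vanishing factor gives [t = i] with [i < s], whence the corner entry [t - s] is the
     negative integer [i - s]. *)
  exists (i%:Z - s%:Z); rewrite qE ti rmorphB; split => //.
  by rewrite Num.Theory.subr_lt0 ltz_nat.
apply/eqP; rewrite prodf_seq_eq0; apply/hasP; exists m; last first.
  by rewrite /= tm subrr.
rewrite mem_index_iota /= -ltz_nat -Num.Theory.subr_lt0.
(* The factor at [m] occurs if [m < s]; both [m - s] and [z] map to the corner entry in [k], hence
   agree in characteristic zero. *)
suff -> : m%:Z - s%:Z = z by [].
apply/eqP; rewrite -subr_eq0 -(intr_eq0_char0 k_char0) !rmorphB /=.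
by rewrite -qz qE tm subrr.
Qed.
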